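(* Let $m\in\mathbb{Z}\setminus\{0\}$, $\xi\in\mathbb{Z}_m$ and let $(\xi_n)_n$ be a sequence of non-zero rational integers such that $|\xi_n|\to\infty$ and $\xi_n\to\xi$ in $\mathbb{Z}_m$. The graph $X=X_{m,\xi}$ (seen here as unoriented) satisfies the following properties: (a) it is a tree; (b) it does not depend (up to equivariant isomorphism) on the choice of the auxiliary sequence $(\xi_n)_n$; (c) the action of the free group $\mathbb{F}_2$ on $X_{m,\xi}$ by left multiplication factors through the canonical projection $\mathbb{F}_2\to\overline{BS}(m,\xi)$.
   Context: A marked group on $k$ generators is a pair $(G,S)$ with $S=(s_1,\dots,s_k)\in G^k$ generating $G$, considered up to isomorphisms respecting the markings. $\mathcal{G}_k$ is the set of marked groups on $k$ generators with the ultrametric $d((G_1,S_1),(G_2,S_2))=e^{-\lambda}$, where $\lambda$ is the word length of a shortest element of the free group $\mathbb{F}_k$ that is trivial in one group and not in the other. For $m,n\in\mathbb{Z}\setminus\{0\}$, $BS(m,n)=\langle a,b\mid ab^ma^{-1}=b^n\rangle$, marked by $(a,b)$. The ring of $m$-adic integers is $\mathbb{Z}_m=\varprojlim_h \mathbb{Z}/m^h\mathbb{Z}$ (the zero ring if $|m|=1$). For $\xi\in\mathbb{Z}_m$, $\overline{BS}(m,\xi)=\lim_{n\to\infty}BS(m,\xi_n)$ in $\mathcal{G}_2$, where $(\xi_n)_n$ is any sequence of non-zero rational integers with $|\xi_n|\to\infty$ and $\xi_n\to\xi$ in $\mathbb{Z}_m$ (it is known that this limit exists and does not depend on the choice of $(\xi_n)_n$);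 it is marked by $(a,b)$. $\mathbb{F}_2$ is the free group on $a,b$. The graph $X=X_{m,\xi}$ associated with $(\xi_n)_n$: let $H_n$ and $H_n^m$ be the subgroups of $BS(m,\xi_n)$ generated by $b$ and by $b^m$, respectively. Let $\sim$ denote the equivalence of sequences that agree for all $n$ large enough. The vertices of $X$ are the $\sim$-classes of sequences $(wH_n)_n\in\prod_n BS(m,\xi_n)/H_n$ with $w\in\mathbb{F}_2$; the (positively) oriented edges are the $\sim$-classes of sequences $(wH_n^m)_n\in\prod_n BS(m,\xi_n)/H_n^m$ with $w\in\mathbb{F}_2$; the edge $(wH_n^m)_n$ has origin $(wH_n)_n$ and terminal vertex $(wa^{-1}H_n)_n$ (these are well defined). $\mathbb{F}_2$ acts on $X$ by left multiplication; equivariance in (b) is with respect to this action. *)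

(* Defs.v *)
From HB Require Import structures.
From mathcomp Require Import all_boot all_order all_algebra.
From mathcomp Require Import all_classical all_reals all_analysis.

Set Implicit Arguments.
Unset Strict Implicit.
Unset Printing Implicit Defensive.

Import Order.TTheory GRing.Theory Num.Theory.
Import numFieldNormedType.Exports.
Local Open Scope classical_set_scope.
Local Open Scope group_scope.

Section Subgroups.
Variable G : groupType.
Implicit Types (g : G) (A H : set G).

Definition is_subgroup H : Prop :=
  H 1 /\ forall x y, H x -> H y -> H (x / y).

Definition generated A : set G :=
  [set x | forall H, is_subgroup H -> A `<=` H -> H x].

Definition lcoset g H : set G := [set g * h | h in H].

Definition lcosets H : set (set G) := [set A | exists g, A = lcoset g H].

Definition expz g (z : int) : G :=
  match z with Posz n => g ^+ n | Negz n => g ^- n.+1 end.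

Lemma generated_subgroup A : is_subgroup (generated A).
Proof.
split=> [H [] //|x y Hx Hy H sH AH].
by case: (sH) => _; apply; [apply: Hx|apply: Hy].
Qed.

Lemma sub_generated A : A `<=` generated A.
Proof. by move=> x Ax H _; apply. Qed.

Lemma subgroupV H x : is_subgroup H -> H x -> H x^-1.
Proof. by move=> [H1 Hd] Hx; rewrite -div1g; apply: Hd. Qed.

Lemma subgroupM H x y : is_subgroup H -> H x -> H y -> H (x * y).
Proof.
by move=> sH Hx Hy; rewrite -(invgK y); apply: sH.2 => //; apply: subgroupV.
Qed.

Lemma subgroupX H x n : is_subgroup H -> H x -> H (x ^+ n).
Proof.
move=> sH Hx; elim: n => [|n IH]; first exact: sH.1.
by rewrite expgS; apply: subgroupM.
Qed.

Lemma subgroup_expz H x z : is_subgroup H -> H x -> H (expz x z).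
Proof.
move=> sH Hx; case: z => n /=; first exact: subgroupX.
by apply: subgroupV => //; apply: subgroupX.
Qed.

Lemma eq_lcoset H x y : is_subgroup H ->
  lcoset x H = lcoset y H <-> H (x^-1 * y).
Proof.
move=> sH; split=> [E|Hxy].
  have : lcoset y H y by exists 1; [exact: sH.1|rewrite mulg1].
  by rewrite -E => -[h Hh <-]; rewrite mulKg.
apply/seteqP; split=> _ [h Hh <-].
  exists ((x^-1 * y)^-1 * h); first by apply: subgroupM => //; apply: subgroupV.
  by rewrite invgM invgK !mulgA mulgV mul1g.
by exists (x^-1 * y * h); [exact: subgroupM|rewrite !mulgA mulgV mul1g].
Qed.

Lemma lcosetM x y H : lcoset x (lcoset y H) = lcoset (x * y) H.
Proof.
apply/seteqP; split=> [_ [_ [h Hh <-] <-]|_ [h Hh <-]].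
  by exists h => //; rewrite mulgA.
by exists (y * h); [exists h|rewrite mulgA].
Qed.

Lemma lcoset1 H : lcoset 1 H = H.
Proof.
apply/seteqP; split=> [_ [h Hh <-]|h Hh]; first by rewrite mul1g.
by exists h => //; rewrite mul1g.
Qed.

End Subgroups.

(* The letter (i, true) is the i-th generator and (i, false) its inverse. *)
Definition word (k : nat) := seq ('I_k * bool).

Definition inv_letter k (l : 'I_k * bool) := (l.1, ~~ l.2).

Definition inv_word k (w : word k) : word k := rev (map (@inv_letter k) w).

Definition pow_word k (i : 'I_k) (z : int) : word k :=
  match z with Posz n => nseq n (i, true) | Negz n => nseq n.+1 (i, false) end.

Section Presentations.
Variables (k : nat) (rel : word k -> word k -> Prop).
Implicit Types u v w : word k.

Inductive word_cong : word k -> word k -> Prop :=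
| wc_refl u : word_cong u u
| wc_sym u v : word_cong u v -> word_cong v u
| wc_trans u v w : word_cong u v -> word_cong v w -> word_cong u w
| wc_cat u u' v v' :
    word_cong u u' -> word_cong v v' -> word_cong (u ++ v) (u' ++ v')
| wc_cancel l : word_cong [:: l; inv_letter l] [::]
| wc_rel u v : rel u v -> word_cong u v.

Definition word_congb u v : bool := `[< word_cong u v >].

Lemma word_congb_refl : reflexive word_congb.
Proof. by move=> u; apply/asboolP; exact: wc_refl. Qed.

Lemma word_congb_sym : symmetric word_congb.
Proof. by move=> u v; apply/asboolP/asboolP; exact: wc_sym. Qed.

Lemma word_congb_trans : transitive word_congb.
Proof.
move=> v u w /asboolP uv /asboolP vw; apply/asboolP.
exact: wc_trans uv vw.
Qed.

Canonical word_congb_equiv :=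
  EquivRel word_congb word_congb_refl word_congb_sym word_congb_trans.

(* The group with k generators, subject to the relations u = v for rel u v. *)
Definition presented := {eq_quot word_congb}%qT.

HB.instance Definition _ := Choice.on presented.

Definition wclass w : presented := (\pi_presented w)%qT.

Lemma wclassP u v : wclass u = wclass v <-> word_cong u v.
Proof.
split=> [/eqquotP/asboolP //|uv].
by apply/eqquotP/asboolP.
Qed.

Lemma wclass_surj (x : presented) : exists w, x = wclass w.
Proof. by exists (repr x); rewrite /wclass reprK. Qed.

Definition pone : presented := wclass [::].
Definition pmul (x y : presented) : presented := wclass (repr x ++ repr y).
Definition pinv (x : presented) : presented := wclass (inv_word (repr x)).

Lemma repr_wclass w : word_cong (repr (wclass w)) w.
Proof. by apply/wclassP; rewrite {1}/wclass reprK. Qed.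

Lemma inv_letterK : involutive (@inv_letter k).
Proof. by move=> [i b]; rewrite /inv_letter /= negbK. Qed.

Lemma inv_word_cat u v : inv_word (u ++ v) = inv_word v ++ inv_word u.
Proof. by rewrite /inv_word map_cat rev_cat. Qed.

Lemma inv_wordK : involutive (@inv_word k).
Proof.
by move=> u; rewrite /inv_word map_rev revK -map_comp map_id_in // => l _;
  rewrite /= inv_letterK.
Qed.

Lemma cong_mulV u : word_cong (u ++ inv_word u) [::].
Proof.
elim: u => [|l u IH]; first exact: wc_refl.
have -> : (l :: u) ++ inv_word (l :: u) =
    [:: l] ++ ((u ++ inv_word u) ++ [:: inv_letter l]).
  by rewrite -(cat1s l u) inv_word_cat !catA.
apply: wc_trans (wc_cancel l).
rewrite -[[:: l; _]]/([:: l] ++ ([::] ++ [:: inv_letter l])).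
by do 2?apply: wc_cat => //; exact: wc_refl.
Qed.

Lemma cong_Vmul u : word_cong (inv_word u ++ u) [::].
Proof. by have := cong_mulV (inv_word u); rewrite inv_wordK. Qed.

Lemma cong_inv u v : word_cong u v -> word_cong (inv_word u) (inv_word v).
Proof.
move=> uv.
apply: (@wc_trans _ (inv_word u ++ (v ++ inv_word v))).
  rewrite -{1}[inv_word u]cats0; apply: wc_cat; first exact: wc_refl.
  exact/wc_sym/cong_mulV.
rewrite catA -{2}[inv_word v]cat0s; apply: wc_cat; last exact: wc_refl.
apply: wc_trans (cong_Vmul u).
by apply: wc_cat; [exact: wc_refl|exact: wc_sym].
Qed.

Lemma pmulE u v : pmul (wclass u) (wclass v) = wclass (u ++ v).
Proof. by apply/wclassP; apply: wc_cat; exact: repr_wclass. Qed.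

Lemma pinvE u : pinv (wclass u) = wclass (inv_word u).
Proof. by apply/wclassP; apply: cong_inv; exact: repr_wclass. Qed.

Lemma pmulA : associative pmul.
Proof.
move=> x y z.
have [u ->] := wclass_surj x; have [v ->] := wclass_surj y.
have [w ->] := wclass_surj z.
by rewrite !pmulE catA.
Qed.

Lemma pmul1 : left_id pone pmul.
Proof. by move=> x; have [u ->] := wclass_surj x; rewrite pmulE. Qed.

Lemma pmulr1 : right_id pone pmul.
Proof. by move=> x; have [u ->] := wclass_surj x; rewrite pmulE cats0. Qed.

Lemma pmulV : left_inverse pone pinv pmul.
Proof.
move=> x; have [u ->] := wclass_surj x.
by rewrite pinvE pmulE; apply/wclassP; exact: cong_Vmul.
Qed.

Lemma pmulrV : right_inverse pone pinv pmul.
Proof.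
move=> x; have [u ->] := wclass_surj x.
by rewrite pinvE pmulE; apply/wclassP; exact: cong_mulV.
Qed.

HB.instance Definition _ :=
  isGroup.Build presented pmulA pmul1 pmulr1 pmulV pmulrV.

Definition pgen (i : 'I_k) : presented := wclass [:: (i, true)].

Lemma wclassM u v : wclass (u ++ v) = wclass u * wclass v.
Proof. by rewrite -pmulE. Qed.

Lemma wclassV u : wclass (inv_word u) = (wclass u)^-1.
Proof. by rewrite -pinvE. Qed.

Lemma wclass_letter i b :
  wclass [:: (i, b)] = if b then pgen i else (pgen i)^-1.
Proof. by case: b => //; rewrite -wclassV. Qed.

Lemma wclass_pow i z : wclass (pow_word i z) = expz (pgen i) z.
Proof.
case: z => n /=.
  elim: n => [//|n IH]; rewrite expgS -IH -wclassM //.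
rewrite -expVgn; elim: n => [|n IH]; first by rewrite expg1 -wclassV.
by rewrite expgS -IH -[(i, false) :: _]cat1s wclassM wclass_letter.
Qed.

Lemma pgen_generates : generated (range pgen) = setT.
Proof.
apply/seteqP; split=> // x _; have [w ->] := wclass_surj x.
have sG := generated_subgroup (range pgen).
elim: w => [|[i b] w IH]; first exact: sG.1.
rewrite -cat1s wclassM; apply: (subgroupM sG) => //.
have Gi : generated (range pgen) (pgen i) by apply: sub_generated; exists i.
by rewrite wclass_letter; case: b => //; exact: (subgroupV sG).
Qed.

End Presentations.

Definition free_group (k : nat) := presented (fun _ _ : word k => False).

(* Marked groups are handled through representatives (G, S); the distance
   below depends only on their classes up to marked isomorphism. *)
Record marked_group (k : nat) := MarkedGroup {
  mg_group :> groupType;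
  mg_gen : 'I_k -> mg_group;
  mg_generates : generated (range mg_gen) = setT }.

Definition presented_marked k (rel : word k -> word k -> Prop) :=
  MarkedGroup (pgen_generates rel).

Section Projection.
Variables (k : nat) (G : marked_group k).

Definition letter_eval (l : 'I_k * bool) : G :=
  if l.2 then mg_gen G l.1 else (mg_gen G l.1)^-1.

Definition word_eval (w : word k) : G :=
  foldr (fun l g => letter_eval l * g) 1 w.

(* The canonical projection F_k -> G. *)
Definition mg_proj (x : free_group k) : G := word_eval (repr x).

Lemma word_eval_cat u v : word_eval (u ++ v) = word_eval u * word_eval v.
Proof. by elim: u => [|l u IH] /=; rewrite ?mul1g // IH mulgA. Qed.

Lemma word_eval_cong u v :
  word_cong (fun _ _ => False) u v -> word_eval u = word_eval v.
Proof.
elim=> // {u v} [u v w _ -> _ -> //|u u' v v' _ Eu _ Ev|[i b]].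
  by rewrite !word_eval_cat Eu Ev.
by case: b; rewrite /= /letter_eval /= mulg1 ?mulgV ?mulVg.
Qed.

Lemma mg_projE w : mg_proj (wclass _ w) = word_eval w.
Proof. by apply: word_eval_cong; exact: repr_wclass. Qed.

Lemma mg_projM x y : mg_proj (x * y) = mg_proj x * mg_proj y.
Proof.
have [u ->] := wclass_surj x; have [v ->] := wclass_surj y.
by rewrite -wclassM !mg_projE word_eval_cat.
Qed.

Lemma mg_proj1 : mg_proj 1 = 1.
Proof. by rewrite -[1]/(wclass _ [::]) mg_projE. Qed.

Lemma mg_projV x : mg_proj x^-1 = (mg_proj x)^-1.
Proof. by apply/esym/mulg1_eq; rewrite -mg_projM mulgV mg_proj1. Qed.

Lemma mg_proj_gen i : mg_proj (pgen _ i) = mg_gen G i.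
Proof. by rewrite mg_projE /= mulg1. Qed.

End Projection.

Definition is_least (P : set nat) (n : nat) : Prop :=
  P n /\ forall j, P j -> (n <= j)%N.

Definition word_length k (x : free_group k) : nat :=
  xget 0%N [set n | is_least [set size w | w in [set w | wclass _ w = x]] n].

Section Distance.
Variables (R : realType) (k : nat).
Implicit Types G : marked_group k.

Definition separates G1 G2 (x : free_group k) : Prop :=
  (mg_proj G1 x = 1 /\ mg_proj G2 x <> 1) \/
  (mg_proj G1 x <> 1 /\ mg_proj G2 x = 1).

Definition mg_dist G1 G2 : R :=
  if pselect (exists x, separates G1 G2 x) then
    expR (- (xget 0%N [set n |
      is_least [set word_length x | x in separates G1 G2] n])%:R)%R
  else 0%R.

Definition mg_cvg (u : nat -> marked_group k) G : Prop :=
  (fun n => mg_dist (u n) G) @ \oo --> (0 : R)%R.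

End Distance.

Definition ga : 'I_2 := ord0.
Definition gb : 'I_2 := ord_max.

Definition BS_rel (m n : int) (u v : word 2) : Prop :=
  u = [:: (ga, true)] ++ pow_word gb m ++ [:: (ga, false)] /\
  v = pow_word gb n.

Definition BS (m n : int) : marked_group 2 := presented_marked (BS_rel m n).

(* For m <> 0, the inverse limit of the sets Z/m^hZ; a residue class mod m^h is
   encoded by its representative in {0, ..., |m|^h - 1}.  Only the set and its
   topology are needed below, not the ring structure. *)
Record madic (m : int) := Madic {
  madic_res : forall h : nat, 'I_(`|m| ^ h)%N;
  madic_compat : forall h,
    (madic_res h.+1 = madic_res h %[mod `|m| ^ h])%N }.

Definition madic_cvg (m : int) (u : nat -> int) (xi : madic m) : Prop :=
  forall h, \forall n \near \oo,
    (u n = (madic_res xi h : nat) %[mod m ^+ h]%R)%Z.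

Definition approximates (m : int) (xi : madic m) (u : nat -> int) : Prop :=
  [/\ forall n, u n <> 0%R,
      (fun n => `|u n|%N) @ \oo --> \oo
    & madic_cvg u xi].

Definition is_limit_BS (R : realType) (m : int) (xi : madic m)
    (L : marked_group 2) : Prop :=
  exists2 u, approximates xi u & mg_cvg R (fun n => BS m (u n)) L.

Record graph := Graph {
  vertex : Type;
  edge : Type;
  origin : edge -> vertex;
  terminus : edge -> vertex }.

Arguments origin {g}.
Arguments terminus {g}.

(* The notions below only see a graph through [ends], hence as unoriented;
   loops and multiple edges are allowed. *)
Definition ends (X : graph) (e : edge X) : set (vertex X) :=
  [set origin e; terminus e].

Definition is_connected (X : graph) : Prop :=
  forall x y : vertex X, exists n (p : nat -> vertex X),
    [/\ p 0%N = x, p n = y &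
      forall i, (i < n)%N -> exists e, ends e = [set p i; p i.+1]].

(* A cycle of length n.+1, possibly 1 (a loop) or 2 (a double edge). *)
Definition is_cycle (X : graph) n (x : 'I_n.+1 -> vertex X)
    (e : 'I_n.+1 -> edge X) : Prop :=
  [/\ injective x, injective e &
    forall i, ends (e i) = [set x i; x (ordS i)]].

Definition is_tree (X : graph) : Prop :=
  [/\ inhabited (vertex X), is_connected X &
    forall n x e, ~ @is_cycle X n x e].

Record graph_action (G : groupType) (X : graph) := GraphAction {
  actv : G -> vertex X -> vertex X;
  acte : G -> edge X -> edge X;
  actv1 : forall x, actv 1 x = x;
  acte1 : forall e, acte 1 e = e;
  actvM : forall g h x, actv (g * h) x = actv g (actv h x);
  acteM : forall g h e, acte (g * h) e = acte g (acte h e);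
  act_ends : forall g e, ends (acte g e) = actv g @` ends e }.

Definition equivariant_iso (G : groupType) (X Y : graph)
    (alpha : graph_action G X) (beta : graph_action G Y) : Prop :=
  exists (f : vertex X -> vertex Y) (phi : edge X -> edge Y),
    [/\ bijective f, bijective phi,
        forall e, ends (phi e) = f @` ends e,
        forall g x, f (actv alpha g x) = actv beta g (f x)
      & forall g e, phi (acte alpha g e) = acte beta g (phi e)].

Definition factors_through (G L : groupType) (X : graph)
    (alpha : graph_action G X) (p : G -> L) : Prop :=
  exists beta : graph_action L X,
    (forall g x, actv alpha g x = actv beta (p g) x) /\
    (forall g e, acte alpha g e = acte beta (p g) e).

Section LimitGraph.
Variables (m : int) (u : nat -> int).

Local Notation F2 := (free_group 2).
Local Notation BSn n := (BS m (u n)).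
Local Notation pr n := (@mg_proj 2 (BSn n)).
Local Notation sequence := (forall n, set (BSn n)).

Definition Hb n : set (BSn n) := generated [set mg_gen (BSn n) gb].
Definition Hbm n : set (BSn n) := generated [set expz (mg_gen (BSn n) gb) m].

Arguments Hb : clear implicits.
Arguments Hbm : clear implicits.

Section Classes.
Variable K : sequence.
Arguments K : clear implicits.

(* The class, in the product of the BS(m, u_n)/K_n, of (w K_n)_n modulo
   eventual equality. *)
Definition coset_class (w : F2) : set sequence :=
  [set s : sequence | (forall n : nat, lcosets (K n) (s n)) /\
           \forall n \near \oo, s n = lcoset (pr n w) (K n)].

Definition cclass : Type := {C : set sequence | exists w, C = coset_class w}.

Lemma eq_cclass (C D : cclass) : sval C = sval D -> C = D.
Proof. by apply: eq_sig_hprop => *; exact: Prop_irrelevance. Qed.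

Definition cls (w : F2) : cclass :=
  exist _ (coset_class w) (ex_intro _ w erefl).

Definition cls_rep (C : cclass) : F2 := sval (cid (svalP C)).

Lemma cls_repK C : cls (cls_rep C) = C.
Proof. by apply: eq_cclass; rewrite /cls_rep /=; case: cid. Qed.

Lemma eq_cls v w : cls v = cls w <->
  \forall n \near \oo, lcoset (pr n v) (K n) = lcoset (pr n w) (K n).
Proof.
split=> [[E]|E].
  have : coset_class v (fun n => lcoset (pr n v) (K n)).
    by split=> [n|]; [eexists|apply: nearW].
  by rewrite E => -[].
apply: eq_cclass; apply/seteqP; split=> s /= [? Hs]; split=> //;
  by apply: filterS2 E Hs => n <- ->.
Qed.

Definition lmul (w : F2) (s : sequence) : sequence :=
  fun n => lcoset (pr n w) (s n).

Lemma lmulM v w s : lmul (v * w) s = lmul v (lmul w s).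
Proof.
by apply: functional_extensionality_dep => n; rewrite /lmul lcosetM mg_projM.
Qed.

Lemma lmul1 s : lmul 1 s = s.
Proof.
by apply: functional_extensionality_dep => n; rewrite /lmul mg_proj1 lcoset1.
Qed.

Lemma lmul_coset_class v w : lmul v @` coset_class w = coset_class (v * w).
Proof.
have sub v' w' s : coset_class w' s -> coset_class (v' * w') (lmul v' s).
  move=> [Cs Es]; split=> [n|].
    by have [g Eg] := Cs n; exists (pr n v' * g); rewrite /lmul Eg lcosetM.
  by apply: filterS Es => n En; rewrite /lmul En lcosetM mg_projM.
apply/seteqP; split=> [_ [s Cs <-]|s Cs]; first exact: sub.
exists (lmul v^-1 s); last by rewrite -lmulM mulgV lmul1.
by rewrite -[w](mulKg v); exact: sub.
Qed.

Lemma cls_act_subproof v (C : cclass) :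
  exists w, lmul v @` sval C = coset_class w.
Proof.
by have [w ->] := svalP C; exists (v * w); rewrite lmul_coset_class.
Qed.

Definition cls_act (v : F2) (C : cclass) : cclass :=
  exist _ (lmul v @` sval C) (cls_act_subproof v C).

Lemma cls_act_cls v w : cls_act v (cls w) = cls (v * w).
Proof. by apply: eq_cclass; rewrite /= lmul_coset_class. Qed.

Lemma cls_act1 C : cls_act 1 C = C.
Proof. by rewrite -(cls_repK C) cls_act_cls mul1g. Qed.

Lemma cls_actM v w C : cls_act (v * w) C = cls_act v (cls_act w C).
Proof. by rewrite -(cls_repK C) !cls_act_cls mulgA. Qed.

End Classes.

(* origin (w H_n^m)_n = (w H_n)_n and terminus (w H_n^m)_n = (w a^-1 H_n)_n;
   independence of w is [XoriginE] and [XterminusE]. *)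
Definition Xorigin (e : cclass Hbm) : cclass Hb := cls Hb (cls_rep e).

Definition Xterminus (e : cclass Hbm) : cclass Hb :=
  cls Hb (cls_rep e * (pgen _ ga)^-1).

Definition limit_graph : graph := Graph Xorigin Xterminus.

Lemma Hb_subgroup n : is_subgroup (Hb n).
Proof. exact: generated_subgroup. Qed.

Lemma Hbm_subgroup n : is_subgroup (Hbm n).
Proof. exact: generated_subgroup. Qed.

Lemma Hbm_sub_Hb n : Hbm n `<=` Hb n.
Proof.
move=> x; apply; first exact: generated_subgroup.
move=> _ ->; apply: (subgroup_expz _ (generated_subgroup _)).
exact: sub_generated.
Qed.

Lemma BS_relE k n (a := mg_gen (BS k n) ga) (b := mg_gen (BS k n) gb) :
  a * expz b k * a^-1 = expz b n.
Proof.
have : wclass (BS_rel k n)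
    ([:: (ga, true)] ++ pow_word gb k ++ [:: (ga, false)]) =
  wclass (BS_rel k n) (pow_word gb n) by apply/wclassP; apply: wc_rel.
by rewrite !wclassM !wclass_pow !wclass_letter mulgA.
Qed.

Lemma conj_Hbm_sub_Hb n x (a := mg_gen (BSn n) ga) :
  Hbm n x -> Hb n (a * x * a^-1).
Proof.
have sH := Hb_subgroup n.
move=> /(_ [set y | Hb n (a * y * a^-1)]); apply.
  split=> [|y z Hy Hz] /=; first by rewrite mulg1 mulgV; apply: sH.1.
  have -> : a * (y / z) * a^-1 = (a * y * a^-1) / (a * z * a^-1).
    by rewrite !invgM invgK !mulgA mulgVK.
  exact: sH.2.
move=> _ -> /=; rewrite BS_relE; apply: (subgroup_expz _ sH).
exact: sub_generated.
Qed.

Lemma XoriginE w : Xorigin (cls Hbm w) = cls Hb w.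
Proof.
have := cls_repK (cls Hbm w); rewrite /Xorigin => /eq_cls E.
apply/eq_cls; apply: filterS E => n.
rewrite !eq_lcoset; first exact: Hbm_sub_Hb.
  exact: Hb_subgroup.
exact: Hbm_subgroup.
Qed.

Lemma XterminusE w : Xterminus (cls Hbm w) = cls Hb (w * (pgen _ ga)^-1).
Proof.
have := cls_repK (cls Hbm w); rewrite /Xterminus => /eq_cls E.
apply/eq_cls; apply: filterS E => n.
rewrite !eq_lcoset; last 2 first.
- exact: Hb_subgroup.
- exact: Hbm_subgroup.
rewrite !mg_projM !mg_projV mg_proj_gen => /conj_Hbm_sub_Hb.
by rewrite invgM invgK !mulgA.
Qed.

Lemma X_ends v (e : edge limit_graph) :
  ends (cls_act v e : edge limit_graph) = cls_act v @` ends e.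
Proof.
rewrite -(cls_repK e) cls_act_cls /ends /= image_setU !image_set1.
by rewrite !XoriginE !XterminusE !cls_act_cls mulgA.
Qed.

(* The action of F_2 by left multiplication. *)
Definition left_mul_action : graph_action F2 limit_graph :=
  @GraphAction F2 limit_graph
    (@cls_act Hb) (@cls_act Hbm) (@cls_act1 Hb) (@cls_act1 Hbm)
    (@cls_actM Hb) (@cls_actM Hbm) X_ends.

End LimitGraph.

(* Main.v *)
(* BS(m, z) acts on the right on the set of normal forms (a stack of syllables
   b^i a^e, followed by a power of b), so an element lies in the coset of <b>
   determined by its stack, and in that of <b^m> determined by its stack and its
   last exponent mod m. The height of a vertex of the Bass-Serre tree is the
   size of its stack; the two ends of an edge differ by 1 in height and a vertex
   has at most one edge going down, hence there is no cycle.
   To pass to the limit, a word in a, b is Britton-reduced simultaneously for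
   all z near xi: the exponents that occur are polynomials in z divided by a
   power of m, and whether such an integer is divisible by m or by z does not
   depend on z, as long as z is large and close to xi. Therefore membership in
   <b> and in <b^m>, as well as heights, are eventually constant along every
   sequence approximating xi, with a value that depends only on xi. *)
Require Import Defs.
From mathcomp Require Import all_boot all_order all_algebra.
From mathcomp Require Import all_classical all_reals all_analysis.
From mathcomp Require Import ring zify.

Set Implicit Arguments.
Unset Strict Implicit.
Unset Printing Implicit Defensive.

(** * Integer powers in a group *)

Section IntegerPowers.
Import GRing.Theory.
Local Open Scope group_scope.
Variable G : groupType.
Implicit Types (g t : G) (x y : int).

Lemma expz_addr1 g x : expz g (x + 1)%R = expz g x * g.
Proof.
case: x => n; first by rewrite -PoszD addn1 /= expgSr.
case: n => [|n]; first by rewrite /= mulVg.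
rewrite (_ : (Negz n.+1 + 1)%R = Negz n); last by lia.
by rewrite /= (expgS g n.+1) invgM mulgVK.
Qed.

Lemma expz_subr1 g x : expz g (x - 1)%R = expz g x * g^-1.
Proof. by rewrite -{2}(subrK 1%R x) expz_addr1 mulgK. Qed.

Lemma expzD g x y : expz g (x + y)%R = expz g x * expz g y.
Proof.
elim/int_ind: y => [|n IH|n IH]; first by rewrite addr0 mulg1.
  by rewrite -addn1 PoszD addrA !expz_addr1 IH mulgA.
by rewrite -addn1 PoszD opprD addrA !expz_subr1 IH mulgA.
Qed.

Lemma expzN g x : expz g (- x)%R = (expz g x)^-1.
Proof. by apply/esym/mulg1_eq; rewrite -expzD subrr. Qed.

Lemma expz1 g : expz g 1%R = g.
Proof. by rewrite /= expg1. Qed.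

(** Conjugation by [t] is a homomorphism, hence respects [q]-th powers; this extends the defining
    relation to all multiples of the exponents. *)
Lemma expz_intertwine g t x y : expz g x * t = t * expz g y ->
  forall q, expz g (x * q)%R * t = t * expz g (y * q)%R.
Proof.
move=> E; have Ev : expz g (- x)%R * t = t * expz g (- y)%R.
  by apply: (mulgI (expz g x)); rewrite mulgA -expzD subrr mul1g mulgA E -mulgA -expzD subrr mulg1.
elim/int_ind => [|n IH|n IH]; first by rewrite !mulr0 mulg1 mul1g.
  by rewrite -addn1 PoszD !mulrDr !mulr1 !expzD -mulgA E !mulgA IH.
by rewrite -addn1 PoszD !opprD !mulrDr !mulrN1 !expzD -mulgA Ev !mulgA IH.
Qed.

Lemma generated1 g : generated [set g]%classic = range (expz g).
Proof.
apply/seteqP; split=> [h|_ [x _ <-]]; last first.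
  by apply: (subgroup_expz x (generated_subgroup _)); exact: sub_generated.
move=> /(_ (range (expz g))); apply; last first.
  by move=> _ ->; exists 1%R => //; rewrite expz1.
split=> [|_ _ [x _ <-] [y _ <-]]; first by exists 0%R.
by exists (x - y)%R => //; rewrite expzD expzN.
Qed.

Lemma expzM g x y : expz g (x * y)%R = expz (expz g x) y.
Proof.
elim/int_ind: y => [|n IH|n IH]; first by rewrite mulr0.
  by rewrite -addn1 PoszD mulrDr mulr1 (expzD g) IH expz_addr1.
by rewrite -addn1 PoszD opprD mulrDr mulrN1 (expzD g) IH expz_subr1 (expzN g).
Qed.

End IntegerPowers.

(** * Normal forms in Baumslag-Solitar groups *)

Section NormalForms.
Import Order.TTheory GRing.Theory Num.Theory.
Local Open Scope ring_scope.
Variables m z : int.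
Hypotheses (m_neq0 : m <> 0) (z_neq0 : z <> 0).

(* In [BS m z], [b ^ (modulus e) * a ^ e = a ^ e * b ^ (modulus (~~ e))],
   where [a ^ true] and [a ^ false] stand for [a] and its inverse. *)
Definition modulus (e : bool) : int := if e then z else m.

(* The state ([:: (i_r, e_r); ...; (i_1, e_1)], k) encodes
   b ^ i_1 * a ^ e_1 * ... * b ^ i_r * a ^ e_r * b ^ k. *)
Definition state : Type := seq (int * bool) * int.

Definition actb (s : state) (x : int) : state := (s.1, s.2 + x).

(** Right multiplication by [a ^ e]: the part of the last exponent divisible by [modulus e] moves
    across the letter and the remainder stays as a digit, unless the digit is 0 and the letter
    cancels the top of the stack. *)
Definition acta (s : state) (e : bool) : state :=
  let r := (s.2 %% modulus e)%Z in
  let x := modulus (~~ e) * (s.2 %/ modulus e)%Z in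
  match s.1 with
  | (i, e') :: t =>
      if (r == 0) && (e' == ~~ e) then (t, i + x) else ((r, e) :: s.1, x)
  | [::] => ([:: (r, e)], x)
  end.

Definition on_top (e : bool) (t : seq (int * bool)) :=
  if t is (_, e') :: _ then e' == e else false.

(** Digits are canonical remainders, and no zero digit separates two mutually inverse letters. *)
Fixpoint reduced (t : seq (int * bool)) : bool :=
  if t is (i, e) :: t' then
    [&& 0 <= i < `|modulus e|, ~~ ((i == 0) && on_top (~~ e) t') & reduced t']
  else true.

Lemma modulus_neq0 e : modulus e != 0.
Proof. by case: e; apply/eqP. Qed.

Lemma actaE s e : acta s e =
  let r := (s.2 %% modulus e)%Z in
  let x := modulus (~~ e) * (s.2 %/ modulus e)%Z in
  if (r == 0) && on_top (~~ e) s.1 then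
    (behead s.1, (head (0, e) s.1).1 + x)
  else ((r, e) :: s.1, x).
Proof. by case: s => [[|[i e'] t] k] //=; rewrite /acta /= andbF. Qed.

Lemma reduced_acta s e : reduced s.1 -> reduced (acta s e).1.
Proof.
move=> rs; rewrite actaE /=; case: ifPn => [_|top] /=.
  by case: s.1 rs => [|[i e'] t] //= /and3P[].
by rewrite modz_ge0 ?ltz_mod ?modulus_neq0 //= top.
Qed.

Lemma divz_digit (d i q : int) : d != 0 -> 0 <= i < `|d| ->
  ((i + d * q) %/ d)%Z = q /\ ((i + d * q) %% d)%Z = i.
Proof.
move=> d0 i_bd; have E : ((i + d * q) %/ d)%Z = q.
  by rewrite addrC mulrC divzMDl // divz_small ?addr0.
by split=> //; rewrite /modz E mulrC addrK.
Qed.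

(** If [acta] cancels a syllable, the bound on its digit makes that digit the next remainder, and
    reducedness prevents a second cancellation, so the syllable is restored. If it pushes one, the
    exponent left is a multiple of [modulus (~~ e)], so the syllable is popped. *)
Lemma actaK s e : reduced s.1 -> acta (acta s e) (~~ e) = s.
Proof.
case: s => t k /= rs; rewrite [acta (t, k) e]actaE /=.
have kE := divz_eq k (modulus e).
case: ifPn => [/andP[/eqP r0 top]|top].
  case: t rs top => //= -[i e'] t /= /and3P[i_bd Ni _] /eqP ?; subst e'.
  rewrite actaE /=.
  have [-> ->] := divz_digit (k %/ modulus e)%Z (modulus_neq0 (~~ e)) i_bd.
  rewrite (negbTE Ni) negbK; congr (_, _).
  by rewrite {2}kE r0 addr0 mulrC.
rewrite actaE /= mulrC modzMl mulzK ?modulus_neq0 // negbK !eqxx /=.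
by congr pair; rewrite {3}kE addrC mulrC.
Qed.

Lemma acta_actb s e q :
  acta (actb s (modulus e * q)) e = actb (acta s e) (modulus (~~ e) * q).
Proof.
rewrite !actaE /actb /= addrC mulrC modzMDl divzMDl ?modulus_neq0 // mulrDr.
by case: ifP => _ /=; congr pair; ring.
Qed.

Definition act (s : state) (l : 'I_2 * bool) : state :=
  if l.1 == ga then acta s l.2 else actb s (if l.2 then 1 else -1).

Definition act_word (s : state) (w : word 2) : state := foldl act s w.

Lemma actb0 s : actb s 0 = s.
Proof. by case: s => t k; rewrite /actb addr0. Qed.

Lemma actbD s x y : actb (actb s x) y = actb s (x + y).
Proof. by rewrite /actb /= addrA. Qed.

Lemma act_word_cat s v w : act_word s (v ++ w) = act_word (act_word s v) w.
Proof. exact: foldl_cat. Qed.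

Lemma act_word_pow s x : act_word s (pow_word gb x) = actb s x.
Proof.
case: x => n /=.
  elim: n s => [|n IH] s /=; first by rewrite actb0.
  by rewrite IH /act /= actbD; congr actb; lia.
elim: n s => [|n IH] s //=.
by rewrite IH /act /= actbD; congr actb; lia.
Qed.

Lemma reduced_act s l : reduced s.1 -> reduced (act s l).1.
Proof. by rewrite /act; case: ifP => // _; exact: reduced_acta. Qed.

Lemma reduced_act_word s w : reduced s.1 -> reduced (act_word s w).1.
Proof. by elim: w s => //= l w IH s rs; apply/IH/reduced_act. Qed.

(** This makes the action descend to [BS m z]; reducedness lets inverse letters act by inverse
    maps. *)
Lemma act_word_cong u v : word_cong (BS_rel m z) u v ->
  forall s, reduced s.1 -> act_word s u = act_word s v.
Proof.
elim=> {u v}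
  [//|u v _ IH s rs|u v w _ IH _ IH' s rs|u u' v v' _ IH _ IH' s rs|[i e] s rs|
   u v [-> ->] s rs].
- by rewrite IH.
- by rewrite IH // IH'.
- by rewrite !act_word_cat IH // IH' //; exact: reduced_act_word.
- rewrite /= /act /=; case: (i == ga); first by exact: (actaK e rs).
  by rewrite actbD; case: e; rewrite ?subrr ?addNr actb0.
- rewrite !act_word_cat !act_word_pow /= /act eqxx.
  (* Crossing the inverse of [a] turns [b ^ m] into [b ^ z]; then [a] and its inverse cancel. *)
  rewrite -[X in actb _ X]mulr1 (@acta_actb _ false 1) mulr1.
  by rewrite (actaK true).
Qed.

Local Notation BSz := (BS m z).
Local Notation b := (mg_gen BSz gb).

Definition pow_a (e : bool) : BSz := wclass (BS_rel m z) [:: (ga, e)].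

(** The orbit map at the base state, computed on an arbitrary representative word. *)
Definition normal_form (g : BSz) : state := act_word ([::], 0) (repr g).

Local Open Scope group_scope.

Lemma normal_form_wclass w :
  normal_form (wclass (BS_rel m z) w) = act_word ([::], 0%R) w.
Proof. by apply: act_word_cong => //; exact: repr_wclass. Qed.

Lemma reduced_normal_form g : reduced (normal_form g).1.
Proof. exact: reduced_act_word. Qed.

Lemma normal_form_mulb g x :
  normal_form (g * expz b x) = actb (normal_form g) x.
Proof.
have [w ->] := wclass_surj g.
by rewrite -[b]/(pgen _ _) -wclass_pow -wclassM !normal_form_wclass
  act_word_cat act_word_pow.
Qed.

Lemma normal_form_mula g e :
  normal_form (g * pow_a e) = acta (normal_form g) e.
Proof.
have [w ->] := wclass_surj g.
by rewrite -wclassM !normal_form_wclass act_word_cat.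
Qed.

Lemma pow_aE e : pow_a e = if e then mg_gen BSz ga else (mg_gen BSz ga)^-1.
Proof. by rewrite /pow_a wclass_letter. Qed.

Lemma pow_aV e : (pow_a e)^-1 = pow_a (~~ e).
Proof. by rewrite !pow_aE; case: e => //=; rewrite invgK. Qed.

Lemma pow_a_intertwine e q :
  expz b (modulus e * q)%R * pow_a e = pow_a e * expz b (modulus (~~ e) * q)%R.
Proof.
apply: expz_intertwine; have E := BS_relE m z.
by case: e; rewrite pow_aE /= -E ?mulgVK // !mulgA mulVg mul1g.
Qed.

Fixpoint stack_val (t : seq (int * bool)) : BSz :=
  if t is (i, e) :: t' then stack_val t' * expz b i * pow_a e else 1.

Definition state_val (s : state) : BSz := stack_val s.1 * expz b s.2.

Lemma state_val_actb s x : state_val (actb s x) = state_val s * expz b x.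
Proof. by rewrite /state_val expzD mulgA. Qed.

Lemma state_val_acta s e : state_val (acta s e) = state_val s * pow_a e.
Proof.
case: s => t k; rewrite /state_val actaE /=; have := divz_eq k (modulus e); rewrite [X in _ = X + _]mulrC.
move: (k %/ _)%Z (k %% _)%Z => q r kE.
case: ifPn => [/andP[/eqP r0]|_] /=.
  case: t => //= -[i e'] t /= /eqP ->.
  rewrite kE r0 addr0 expzD -!mulgA pow_a_intertwine.
  by rewrite -pow_aV mulKg.
by rewrite kE addrC expzD -!mulgA pow_a_intertwine.
Qed.

Lemma state_val_act s l :
  state_val (act s l) = state_val s * wclass (BS_rel m z) [:: l].
Proof.
case: l => i e; rewrite /act /=; case: eqP => [->|/eqP i_b].
  exact: state_val_acta.
rewrite state_val_actb wclass_letter (_ : i = gb).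
  by case: e.
by apply/val_inj; case: i i_b => -[|[|i]].
Qed.

(** Evaluation turns the action of a word into right multiplication by it; hence normal forms
    separate elements. *)
Lemma normal_formK : cancel normal_form state_val.
Proof.
move=> g; have [w ->] := wclass_surj g; rewrite normal_form_wclass.
suff E s : state_val (act_word s w) = state_val s * wclass _ w.
  by rewrite E /state_val /= !mul1g.
elim: w s => [|l w IH] s; first by rewrite /= mulg1.
by rewrite /= IH state_val_act -mulgA -[l :: w]cat1s (wclassM _ [:: l] w).
Qed.

(** Powers of [b] only change the last exponent; conversely, elements with equal stacks differ by a
    power of [b], since normal forms separate elements. *)
Lemma lcoset_genb g h :
  lcoset g (generated [set b]%classic) = lcoset h (generated [set b]%classic)
  <-> (normal_form g).1 = (normal_form h).1.
Proof.
rewrite eq_lcoset; last exact: generated_subgroup.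
rewrite generated1; split=> [[x _ E]|E].
  by rewrite -[h](mulVKg g) -E normal_form_mulb.
exists ((normal_form h).2 - (normal_form g).2)%R => //.
apply: (mulgI g); rewrite mulVKg -[LHS]normal_formK -[RHS]normal_formK.
rewrite normal_form_mulb /actb E; congr state_val.
by case: (normal_form h) => t k /=; congr pair; ring.
Qed.

Lemma lcoset_genbm g h (K := generated [set expz b m]%classic) :
  lcoset g K = lcoset h K <->
  (normal_form g).1 = (normal_form h).1 /\
  (m %| (normal_form h).2 - (normal_form g).2)%Z.
Proof.
rewrite eq_lcoset; last exact: generated_subgroup.
rewrite /K generated1; split=> [[x _ E]|[E /dvdzP[q Eq]]].
  rewrite -[h](mulVKg g) -E -expzM normal_form_mulb; split=> //=.
  by rewrite addrC addKr dvdz_mulr.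
exists q => //; rewrite -expzM mulrC -Eq.
apply: (mulgI g); rewrite mulVKg -[LHS]normal_formK -[RHS]normal_formK.
rewrite normal_form_mulb /actb E; congr state_val.
by case: (normal_form h) => t k /=; congr pair; ring.
Qed.


End NormalForms.

(** * Heights in the Bass-Serre tree *)

Section Depth.
Import Order.TTheory GRing.Theory Num.Theory.
Local Open Scope ring_scope.
Variables m z : int.
Hypotheses (m_neq0 : m <> 0) (z_neq0 : z <> 0).
Implicit Types (s : state) (e : bool).
Local Notation acta := (acta m z).
Local Notation modulus := (modulus m z).
Local Notation normal_form := (@normal_form m z).
Local Notation BSz := (BS m z).
Local Notation b := (mg_gen BSz gb).

(** The cancellation test of [acta], with the zero remainder written as divisibility. *)
Definition pops s e := on_top (~~ e) s.1 && (modulus e %| s.2)%Z.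

Lemma size_acta s e :
  if pops s e then size s.1 = (size (acta s e).1).+1
  else size (acta s e).1 = (size s.1).+1.
Proof.
have -> : pops s e = ((s.2 %% modulus e)%Z == 0) && on_top (~~ e) s.1.
  by rewrite andbC /pops; congr andb; apply/dvdz_mod0P/eqP.
rewrite actaE /=; case: ifP => [top|->] //; rewrite top.
by move: top; rewrite andbC; case: s.1.
Qed.

Lemma acta_shrink s e : (size (acta s e).1 < size s.1)%N = pops s e.
Proof. by have := size_acta s e; case: ifP => _ ->; [rewrite leqnn|rewrite ltnNge leqnSn]. Qed.

Lemma acta_grow s e : reduced m z s.1 ->
  (size s.1 < size (acta s e).1)%N -> pops (acta s e) (~~ e).
Proof. by move=> rs; rewrite -acta_shrink actaK. Qed.

Definition depth (g : BSz) : nat := size (normal_form g).1.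

Lemma depth_mula (g : BSz) e :
  depth (g * pow_a m z e)%g = (depth g).+1 \/
  depth g = (depth (g * pow_a m z e)%g).+1.
Proof.
rewrite /depth normal_form_mula //.
by have := size_acta (normal_form g) e; case: ifP; [right|left].
Qed.

Local Notation H := (generated [set b]%classic).
Local Notation Hm := (generated [set expz b m]%classic).
Local Notation a' := (pow_a m z false).
Local Open Scope group_scope.

(** Descending along [a'] forces the last exponent to be a multiple of [m], which leaves a single
    coset of [b ^ m]. *)
Lemma descending_origin_unique (g h : BSz) : lcoset g H = lcoset h H ->
  (depth (g * a') < depth g)%N -> (depth (h * a') < depth h)%N ->
  lcoset g Hm = lcoset h Hm.
Proof.
rewrite lcoset_genb // => E; rewrite /depth !normal_form_mula // !acta_shrink.
move=> /andP[_ mg] /andP[_ mh]; apply/lcoset_genbm => //.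
by split=> //; rewrite rpredB.
Qed.

(** After the push by [a'], both last exponents are multiples of [z], hence differ by some [z * q];
    stepping back by [a] turns this difference into [m * q]. *)
Lemma descending_terminus_unique (g h : BSz) :
  lcoset (g * a') H = lcoset (h * a') H ->
  (depth g < depth (g * a'))%N -> (depth h < depth (h * a'))%N ->
  lcoset g Hm = lcoset h Hm.
Proof.
rewrite lcoset_genb // => E; rewrite /depth !normal_form_mula // in E *.
have rg := reduced_normal_form m_neq0 z_neq0 g.
have rh := reduced_normal_form m_neq0 z_neq0 h.
move=> /(acta_grow rg)/andP[_ zg] /(acta_grow rh)/andP[_ zh].
apply/lcoset_genbm => //.
have /dvdzP[q Eq] := rpredB zh zg.
rewrite -(actaK m_neq0 z_neq0 false rg) -(actaK m_neq0 z_neq0 false rh).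
suff -> : acta (normal_form h) false =
    actb (acta (normal_form g) false) (modulus true * q)%R.
  by rewrite acta_actb //; split=> //=; rewrite addrC addKr dvdz_mulr.
rewrite mulrC -Eq /actb E.
by case: (acta _ _) => t k /=; congr pair; ring.
Qed.

(** The common stack would end with [a], which [a'] removes, and also with the inverse of [a], which
    [a'] has just pushed. *)
Lemma descending_origin_terminus (g h : BSz) : lcoset g H = lcoset (h * a') H ->
  (depth (g * a') < depth g)%N -> (depth h < depth (h * a'))%N -> False.
Proof.
rewrite lcoset_genb // => E; rewrite /depth !normal_form_mula // in E *.
rewrite acta_shrink => /andP[+ _].
move=> + /(acta_grow (reduced_normal_form m_neq0 z_neq0 h))/andP[+ _].
by rewrite E; case: (acta _ _).1 => //= -[_ []].
Qed.

End Depth.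

(** * Properties decided near [xi] and simultaneous Britton reduction *)

Section NearXi.
Import Order.TTheory GRing.Theory Num.Theory.
Local Open Scope ring_scope.
Local Open Scope classical_set_scope.
Variables (m : int) (xi : madic m).
Hypothesis m_neq0 : m <> 0.

(** All approximating sequences are quantified over at once, so that conclusions can be carried from
    one to another. *)
Definition near_xi (P : int -> Prop) : Prop :=
  forall u, approximates xi u -> \forall n \near \oo, P (u n).

Lemma near_xiT (P : int -> Prop) : (forall z, P z) -> near_xi P.
Proof. by move=> PT u _; apply: nearW. Qed.

Lemma near_xiS (P Q : int -> Prop) :
  (forall z, P z -> Q z) -> near_xi P -> near_xi Q.
Proof. by move=> PQ nP u hu; apply: filterS (nP u hu) => n; apply: PQ. Qed.

Lemma near_xiS2 (P Q W : int -> Prop) :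
  (forall z, P z -> Q z -> W z) -> near_xi P -> near_xi Q -> near_xi W.
Proof.
by move=> PQ nP nQ u hu; apply: filterS2 (nP u hu) (nQ u hu) => n; apply: PQ.
Qed.

Lemma near_xi_and (P Q : int -> Prop) :
  near_xi P -> near_xi Q -> near_xi (fun z => P z /\ Q z).
Proof. exact: near_xiS2. Qed.

Lemma near_xi_neq0 : near_xi (fun z => z <> 0).
Proof. by move=> u [u0 _ _]; apply: nearW. Qed.

Lemma near_xi_large (N : nat) : near_xi (fun z => (N <= `|z|)%N).
Proof. by move=> u [_ /cvgnyPge + _] => /(_ N). Qed.

Lemma near_xi_mod h :
  near_xi (fun z => (z = (madic_res xi h : nat) %[mod m ^+ h])%Z).
Proof. by move=> u [_ _ /(_ h)]. Qed.

Definition near_decided (P : int -> Prop) : Prop :=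
  near_xi P \/ near_xi (fun z => ~ P z).

(* Near xi, f is a polynomial over Z[1/m] with integer values. *)
Definition tame (f : int -> int) : Prop :=
  exists d (p : {poly int}), near_xi (fun z => f z * m ^+ d = p.[z]).

Lemma tame_cst c : tame (fun=> c).
Proof. by exists 0%N, c%:P; apply: near_xiT => z; rewrite hornerC mulr1. Qed.

Lemma tameD f g : tame f -> tame g -> tame (fun z => f z + g z).
Proof.
move=> [d [p fp]] [d' [q gq]]; exists (d + d')%N, (m ^+ d' *: p + m ^+ d *: q).
apply: near_xiS2 fp gq => z fz gz.
by rewrite hornerD !hornerZ -fz -gz exprD; ring.
Qed.

Lemma tame_modulus e f : tame f -> tame (fun z => modulus m z e * f z).
Proof.
move=> [d [p fp]]; exists d, ((if e then 'X else m%:P) * p).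
apply: near_xiS fp => z fz.
by rewrite hornerM -fz /modulus; case: e; rewrite ?hornerX ?hornerC mulrA.
Qed.

Lemma horner_eqmod (p : {poly int}) (x y d : int) :
  (x = y %[mod d])%Z -> (p.[x] = p.[y] %[mod d])%Z.
Proof.
move=> /eqP; rewrite eqz_mod_dvd => xy; apply/eqP; rewrite eqz_mod_dvd.
elim/poly_ind: p => [|p c /dvdzP[k IH]]; first by rewrite !horner0 subrr.
have /dvdzP[l El] := xy.
rewrite !hornerE; apply/dvdzP; exists (k * x + p.[y] * l).
by rewrite mulrDl mulrAC -IH -mulrA -El; ring.
Qed.

(** The value of [p] modulo [m ^+ d] depends only on [z] modulo [m ^+ d], which is eventually that
    of [xi]. *)
Lemma horner_dvd_decided (p : {poly int}) d :
  near_decided (fun z => (m ^+ d %| p.[z])%Z).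
Proof.
have [dv|ndv] := boolP (m ^+ d %| p.[(madic_res xi d : nat)%:Z])%Z; [left|right];
  apply: near_xiS (near_xi_mod d) => z /(horner_eqmod p) Ez.
  by apply/dvdz_mod0P; rewrite Ez; apply/dvdz_mod0P.
by move/dvdz_mod0P; rewrite Ez => /dvdz_mod0P; apply/negP.
Qed.

Lemma dvdz_denom (x : int) d k : (m ^+ (d + k) %| x * m ^+ d)%Z = (m ^+ k %| x)%Z.
Proof.
by rewrite exprD mulrC dvdz_mul2l // expf_neq0 //; apply/eqP.
Qed.

Lemma tame_dvd f e : tame f ->
  near_xi (fun z => (modulus m z e %| f z)%Z) /\
    tame (fun z => f z %/ modulus m z e)%Z \/
  near_xi (fun z => ~~ (modulus m z e %| f z)%Z).
Proof.
move=> [d [p fp]]; case: e; rewrite /modulus.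
  have [[q c] /= Ep] : exists qc, p = qc.1 * 'X + qc.2%:P :> {poly int}.
    by elim/poly_ind: p {fp} => [|q c _]; [exists (0, 0); rewrite mul0r addr0|exists (q, c)].
  have pE z : p.[z] = q.[z] * z + c by rewrite Ep !hornerE.
  have [c0|c0] := eqVneq c 0; last first.
    (* If [z] divides [f z], it divides [p.[z]] and thus the constant term [c], which is impossible
       once [z] exceeds [c] in absolute value. *)
    right; apply: near_xiS2 fp (near_xi_large `|c|.+1) => z fz zc.
    apply/negP => zf; have : (z %| c)%Z.
      by rewrite -(rpredDl _ (dvdz_mull q.[z] (dvdzz z))) -pE -fz dvdz_mulr.
    move=> /(dvdn_leq _); rewrite absz_gt0 c0 => /(_ isT).
    by rewrite leqNgt zc.
  (* With [c = 0], [z] divides [f z] iff [m ^+ d] divides [q.[z]], and then the quotient is [q.[z]]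
     over [m ^+ d]. *)
  have [qd|qd] := horner_dvd_decided q d; [left; split|right].
  - apply: near_xiS2 (near_xi_and fp qd) near_xi_neq0 => z [fz /dvdzP[k qz]] z0.
    apply/dvdzP; exists k; apply: (mulIf (x := m ^+ d)).
      by rewrite expf_neq0 //; apply/eqP.
    by rewrite fz pE c0 qz; ring.
  - exists d, q.
    apply: near_xiS2 (near_xi_and fp qd) near_xi_neq0 => z [fz /dvdzP[k qz]] z0.
    have -> : f z = k * z.
      apply: (mulIf (x := m ^+ d)); first by rewrite expf_neq0 //; apply/eqP.
      by rewrite fz pE c0 qz; ring.
    by rewrite mulzK ?qz //; apply/eqP.
  - apply: near_xiS2 (near_xi_and fp qd) near_xi_neq0 => z [fz qz] z0.
    apply/negP => /dvdzP[k fk]; apply: qz; apply/dvdzP; exists k.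
    apply: (mulIf (x := z)); first exact/eqP.
    by move: fz; rewrite pE c0 addr0 fk => <-; ring.
(* Division by [m] only raises the exponent of the denominator by one. *)
have mf : forall z, f z * m ^+ d = p.[z] -> (m %| f z)%Z = (m ^+ (d + 1) %| p.[z])%Z.
  by move=> z <-; rewrite dvdz_denom.
have [pd|pd] := horner_dvd_decided p (d + 1); [left; split|right].
- by apply: near_xiS2 fp pd => z /mf ->.
- exists (d + 1)%N, p; apply: near_xiS2 fp pd => z fz.
  rewrite -mf // => mfz; rewrite -fz exprD expr1 mulrCA mulrC; congr (_ * _).
  by rewrite divzK.
- by apply: near_xiS2 fp pd => z /mf -> /negP.
Qed.

(* Words b ^ f_1 * a ^ e_1 * ... * b ^ f_r * a ^ e_r whose exponents depend on
   z, listed from the last syllable to the first; the predicate [pushes] below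
   says that such a word is Britton-reduced at z. *)
Definition syllables : Type := seq ((int -> int) * bool).

Fixpoint run (s : syllables) (z : int) : state :=
  if s is (f, e) :: s' then acta m z (actb (run s' z) (f z)) e
  else ([::], 0).

Fixpoint all_tame (s : syllables) : Prop :=
  if s is (f, _) :: s' then tame f /\ all_tame s' else True.

Fixpoint pushes (s : syllables) (z : int) : Prop :=
  if s is (_, _) :: s' then
    (size (run s' z).1 < size (run s z).1)%N /\ pushes s' z
  else True.

Lemma reduced_run s z : z <> 0 -> reduced m z (run s z).1.
Proof. by move=> z0; elim: s => //= -[f e] s IH; apply: reduced_acta. Qed.

Lemma size_run s z : pushes s z -> size (run s z).1 = size s.
Proof.
elim: s => //= -[f e] s IH [+ /IH <-].
by have := size_acta m z (actb (run s z) (f z)) e; case: ifP => //= _ ->;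
  rewrite ltnNge leqnSn.
Qed.

Lemma near_run_push s f e :
  near_xi (pushes s) ->
  near_xi (fun z => ~~ pops m z (actb (run s z) (f z)) e) ->
  near_xi (pushes ((f, e) :: s)).
Proof.
apply: near_xiS2 => z ps npop; split=> //=.
by have := size_acta m z (actb (run s z) (f z)) e; rewrite (negbTE npop) => ->.
Qed.

(** Since [e'] was pushed, it is on top and the exponent behind it is a multiple of
    [modulus (~~ e')]; when [e' = ~~ e], only the divisibility of [f z] remains to be tested. *)
Lemma run_pops s f f' e e' z : z <> 0 -> pushes ((f', e') :: s) z ->
  pops m z (actb (run ((f', e') :: s) z) (f z)) e =
  (e' == ~~ e) && (modulus m z e %| f z)%Z.
Proof.
move=> z0 [/= grow _].
have r0 := reduced_run s z0.
have := acta_grow m_neq0 z0 (s := actb (run s z) (f' z)) r0 grow.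
rewrite /pops /= negbK; case: (acta _ _ _ _) => -[|[i e1] t] k //=.
move=> /andP[/eqP ->]; case: eqP => //= ->; rewrite negbK => dv.
by rewrite rpredDl.
Qed.

(** Induction on the last letter. A letter [b] changes the final exponent; for a letter [a],
    [tame_dvd] makes the choice between push and cancellation uniform near [xi], and exponents stay
    tame. *)
Lemma syllables_of_word (w : word 2) : exists s f, [/\ all_tame s, tame f,
  near_xi (pushes s) &
  near_xi (fun z => act_word m z ([::], 0) w = actb (run s z) (f z))].
Proof.
elim/last_ind: w => [|w [i e] [s [f [ts tf ps Ew]]]].
  exists [::], (fun=> 0); split=> //; first exact: tame_cst.
  - exact: near_xiT.
  - by apply: near_xiT => z; rewrite actb0.
have Er z : act_word m z ([::], 0) (rcons w (i, e)) =
    act m z (act_word m z ([::], 0) w) (i, e) by rewrite /act_word foldl_rcons.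
have [i_a|i_b] := boolP (i == ga); last first.
  exists s, (fun z => f z + (if e then 1 else -1)); split=> //.
    by apply: tameD => //; apply: tame_cst.
  by apply: near_xiS Ew => z; rewrite Er => ->; rewrite /act (negbTE i_b) actbD.
have push : near_xi (fun z => ~~ pops m z (actb (run s z) (f z)) e) ->
  exists s f, [/\ all_tame s, tame f, near_xi (pushes s) &
  near_xi (fun z => act_word m z ([::], 0) (rcons w (i, e)) =
                    actb (run s z) (f z))].
  (* The new exponent is 0 because what the push leaves behind the letter is already part of
     [run]. *)
  move=> np; exists ((f, e) :: s), (fun=> 0); split=> //.
  - exact: tame_cst.
  - exact: near_run_push.
  by apply: near_xiS Ew => z; rewrite Er => ->; rewrite /act i_a actb0.
case: s ts ps Ew push => [|[f' e'] s] ts ps Ew push.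
  by apply: push; apply: near_xiT.
have npE := near_xiS2 (@run_pops s f f' e e') near_xi_neq0 ps.
have [e'e|e'e] := boolP (e' == ~~ e); last first.
  by apply: push; apply: near_xiS npE => z ->; rewrite (negbTE e'e).
have [[dv tq]|ndv] := tame_dvd e tf; last first.
  by apply: push; apply: near_xiS2 npE ndv => z -> /negbTE ->; rewrite andbF.
case: ts => tf' ts.
(* Moving [f z] across the cancelled letter replaces its factor [modulus e] by [modulus (~~ e)]. *)
exists s, (fun z => f' z + modulus m z (~~ e) * (f z %/ modulus m z e)%Z).
split=> //; first by apply: tameD => //; apply: tame_modulus.
  by apply: near_xiS ps => z [].
apply: near_xiS2 (near_xi_and Ew dv) near_xi_neq0 => z [E dvz] z0.
rewrite Er E /act i_a /= (eqP e'e) -(divzK dvz) mulrC.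
rewrite mulrC mulzK ?modulus_neq0 // [X in actb _ X]mulrC acta_actb //.
have := actaK m_neq0 z0 (~~ e) (s := actb (run s z) (f' z)) (reduced_run s z0).
by rewrite negbK => ->; rewrite actbD.
Qed.

Lemma near_size_act_word (w : word 2) :
  exists r, near_xi (fun z => size (act_word m z ([::], 0) w).1 = r).
Proof.
have [s [f [_ _ ps Ew]]] := syllables_of_word w; exists (size s).
by apply: near_xiS2 ps Ew => z /size_run <- ->.
Qed.

Lemma near_decided_genbm (w : word 2) (s := fun z => act_word m z ([::], 0) w) :
  near_decided (fun z => (s z).1 = [::] /\ (m %| (s z).2)%Z).
Proof.
rewrite /s; have [[|x t] [f [_ tf ps Ew]]] := syllables_of_word w.
  have [[dv _]|ndv] := tame_dvd false tf; [left|right].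
    by apply: near_xiS2 Ew dv => z -> /=; rewrite add0r.
  by apply: near_xiS2 Ew ndv => z -> /=; rewrite add0r => /negP nd [].
right; apply: near_xiS2 ps Ew => z /size_run + -> [/= E _].
by rewrite E.
Qed.

Lemma near_decided_genb (w : word 2) :
  near_decided (fun z => (act_word m z ([::], 0) w).1 = [::]).
Proof.
have [[|r] nr] := near_size_act_word w; [left|right]; apply: near_xiS nr => z.
  by move/size0nil.
by move=> + E; rewrite E.
Qed.

End NearXi.

(** * Convergence of marked groups and factorization of actions *)

Section MarkedLimits.
Import Order.TTheory GRing.Theory Num.Theory.
Import numFieldNormedType.Exports.
Local Open Scope classical_set_scope.
Local Open Scope group_scope.

Lemma ex_least (P : set nat) : P !=set0 -> exists n, is_least P n.
Proof.
move=> [n0 Pn0]; have ex : exists n, `[< P n >] by exists n0; apply/asboolP.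
exists (ex_minn ex); case: ex_minnP => n /asboolP Pn least.
by split=> // j Pj; apply/least/asboolP.
Qed.

(** Whenever [x] is not trivial in [s n], it separates [s n] from [L] and keeps their distance at
    least [expR (- word_length x)]. *)
Lemma mg_cvg_trivial (R : realType) k (s : nat -> marked_group k)
    (L : marked_group k) (x : free_group k) :
  mg_cvg R s L -> mg_proj L x = 1 -> \forall n \near \oo, mg_proj (s n) x = 1.
Proof.
move=> sL Lx.
have lt0 : (0 < expR (- (word_length x)%:R) :> R)%R by apply: expR_gt0.
have close := cvgr_lt _ sL _ lt0; apply: filterS (close _) => n lt_d; apply: contrapT => nx.
have sep : separates (s n) L x by right.
move: lt_d; rewrite /mg_dist; case: pselect => [?|[]]; last by exists x.
have lengths : [set word_length y | y in separates (s n) L] !=set0.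
  by exists (word_length x), x.
have [r /(xgetI 0%N)] := ex_least lengths; set d := xget _ _.
move=> [_ /(_ (word_length x))] le; apply/negP; rewrite -leNgt.
by rewrite ler_expR lerN2 ler_nat; apply: le; exists x.
Qed.

Lemma mg_proj_surj k (L : marked_group k) (g : L) : exists x, mg_proj L x = g.
Proof.
have : generated (range (mg_gen L)) g by rewrite mg_generates.
move=> /(_ (range (mg_proj L)))[].
- split=> [|_ _ [x _ <-] [y _ <-]]; first by exists 1 => //; exact: mg_proj1.
  by exists (x / y) => //; rewrite mg_projM mg_projV.
- by move=> _ [i _ <-]; exists (pgen _ i) => //; rewrite mg_proj_gen.
by move=> x _ <-; exists x.
Qed.

Lemma mg_proj_presented k (rel : word k -> word k -> Prop) (x : free_group k) :
  mg_proj (presented_marked rel) x = wclass rel (repr x).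
Proof.
rewrite /mg_proj; elim: (repr x) => [//|[i e] w IH] /=.
by rewrite IH -[(i, e) :: w]cat1s wclassM wclass_letter.
Qed.

(** Let each element act through a chosen preimage: two preimages differ by an element of the
    kernel, which acts trivially. *)
Lemma factors_through_ker (G L : groupType) (X : graph)
    (alpha : graph_action G X) (p : G -> L) :
  {morph p : x y / x * y} -> (forall g, exists x, p x = g) ->
  (forall x, p x = 1 -> (forall v, actv alpha x v = v) /\
                        (forall e, acte alpha x e = e)) ->
  factors_through alpha p.
Proof.
move=> pM psurj ker; pose sec g := sval (cid (psurj g)).
have secK g : p (sec g) = g by rewrite /sec; case: cid.
have p1 : p 1 = 1 by apply: (mulgI (p 1)); rewrite -pM !mulg1.
have eq_act x y : p x = p y -> (forall v, actv alpha x v = actv alpha y v) /\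
    (forall e, acte alpha x e = acte alpha y e).
  move=> pxy; have /ker[Ev Ee] : p (x^-1 * y) = 1.
    by rewrite pM -pxy -pM mulVg.
  by split=> [v|e]; rewrite -[y in RHS](mulVKg x) ?(actvM _ x) ?(acteM _ x) ?Ev ?Ee.
have act1 : p (sec 1) = p 1 by rewrite secK p1.
have actM g h : p (sec (g * h)) = p (sec g * sec h) by rewrite pM !secK.
unshelve eexists (@GraphAction L X (fun g => actv alpha (sec g))
  (fun g => acte alpha (sec g)) _ _ _ _ _).
- by move=> v; rewrite /= (eq_act _ _ act1).1 actv1.
- by move=> e; rewrite /= (eq_act _ _ act1).2 acte1.
- by move=> g h v; rewrite /= (eq_act _ _ (actM g h)).1 actvM.
- by move=> g h e; rewrite /= (eq_act _ _ (actM g h)).2 acteM.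
- by move=> g e; rewrite act_ends.
by split=> g v /=; have /eq_act[Ev Ee] := secK (p g); rewrite ?Ev ?Ee.
Qed.

End MarkedLimits.

(** * Paths, and acyclicity from a height function *)

Section Graphs.
Local Open Scope classical_set_scope.
Variable X : graph.

Definition reachable (x y : vertex X) := exists n (p : nat -> vertex X),
  [/\ p 0%N = x, p n = y &
      forall i, (i < n)%N -> exists e, ends e = [set p i; p i.+1]].

Lemma reachable_refl x : reachable x x.
Proof. by exists 0%N, (fun=> x). Qed.

Lemma reachable_step x y z (e : edge X) :
  ends e = [set y; z] -> reachable x y -> reachable x z.
Proof.
move=> Ee [n [p [p0 pn pe]]].
exists n.+1, (fun i => if (i <= n)%N then p i else z).
split=> [//||i]; first by rewrite ltnn.
rewrite ltnS => lein; rewrite lein; case: ltnP => [ltin|leni].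
  exact: pe.
by have -> : i = n; [apply/eqP; rewrite eqn_leq lein|exists e; rewrite pn].
Qed.

Variable height : vertex X -> nat.

Definition descends (e : edge X) (v : vertex X) : Prop :=
  origin e = v /\ (height (terminus e) < height v)%N \/
  terminus e = v /\ (height (origin e) < height v)%N.

Hypothesis height_neq :
  forall e : edge X, height (origin e) <> height (terminus e).

(** Ends of different heights exclude a loop and make the inequality strict. *)
Lemma ends_descends (e : edge X) v w :
  ends e = [set v; w] -> (height w <= height v)%N -> descends e v.
Proof.
move=> E wv; have ne := @height_neq e.
have [] : ends e v /\ ends e w by rewrite E; split; [left|right].
rewrite /descends => Ev Ew; case: Ev Ew E wv => -> [] -> E wv.
- have : [set origin e; origin e] (terminus e) by rewrite -E; right.
  by case=> Eo; rewrite Eo in ne.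
- by left; split=> //; move/eqP: ne wv; case: ltngtP.
- by right; split=> //; move/eqP: ne wv; case: ltngtP.
- have : [set terminus e; terminus e] (origin e) by rewrite -E; left.
  by case=> Eo; rewrite Eo in ne.
Qed.

(* At a vertex of maximal height, both edges of a cycle descend. *)
Lemma acyclic_of_height :
  (forall e e' v, descends e v -> descends e' v -> e = e') ->
  forall n x e, ~ @is_cycle X n x e.
Proof.
move=> uniq_desc n x e [x_inj e_inj Ee].
have [i _ i_max] := @arg_maxnP _ (ord0 : 'I_n.+1) xpredT (height \o x) isT.
have d1 : descends (e i) (x i).
  by apply: ends_descends (Ee i) _; exact: i_max.
have d2 : descends (e (ord_pred i)) (x i).
  apply: (@ends_descends _ _ (x (ord_pred i))); last exact: i_max.
  by rewrite Ee ord_predK setUC.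
(* The two edges at the summit coincide, so [i] is its own predecessor and the edge is a loop, with
   ends of equal height. *)
have /e_inj Ei := uniq_desc _ _ _ d1 d2.
have : ends (e i) = [set x i; x i] by rewrite Ee {2}Ei ord_predK.
move=> Eii; have o : [set x i; x i] (origin (e i)) by rewrite -Eii; left.
have t : [set x i; x i] (terminus (e i)) by rewrite -Eii; right.
by apply: (@height_neq (e i)); case: o => ->; case: t => ->.
Qed.

End Graphs.

(** * Equality of classes depends only on [xi] *)

Section LimitGraph.
Import Order.TTheory GRing.Theory Num.Theory.
Local Open Scope classical_set_scope.
Local Open Scope group_scope.
Variables (m : int) (xi : madic m).
Hypothesis m_neq0 : m <> 0%R.
Local Notation F2 := (free_group 2).
Local Notation pr z := (@mg_proj 2 (BS m z)).

(** Indexing by the integer [z] rather than by [n] allows different sequences to be substituted in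
    the same family. *)
Definition genb z : set (BS m z) := generated [set mg_gen (BS m z) gb].
Definition genbm z : set (BS m z) := generated [set expz (mg_gen (BS m z) gb) m].

Arguments genb : clear implicits.
Arguments genbm : clear implicits.

Lemma near_decided_iff (P Q : int -> Prop) :
  near_xi xi (fun z => P z <-> Q z) -> near_decided xi P -> near_decided xi Q.
Proof.
by move=> PQ [nP|nP]; [left|right]; apply: near_xiS2 PQ nP => z [PQ QP]; tauto.
Qed.

Definition decided (K : forall z, set (BS m z)) : Prop := forall x y : F2,
  near_decided xi (fun z => lcoset (pr z x) (K z) = lcoset (pr z y) (K z)).

Lemma normal_form_proj z (x : F2) : z <> 0%R ->
  normal_form (pr z x) = act_word m z ([::], 0%R) (repr x).
Proof. by move=> z0; rewrite mg_proj_presented normal_form_wclass. Qed.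

Lemma lcoset_translate z (K : set (BS m z)) (x y : F2) : is_subgroup K ->
  lcoset (pr z x) K = lcoset (pr z y) K <->
  lcoset 1 K = lcoset (pr z (x^-1 * y)) K.
Proof. by move=> sK; rewrite !eq_lcoset // invg1 mul1g mg_projM mg_projV. Qed.

Lemma normal_form1 z : z <> 0%R -> normal_form (1 : BS m z) = ([::], 0%R).
Proof. by move=> z0; rewrite -[1]/(wclass _ [::]) normal_form_wclass. Qed.

Lemma decided_genb : decided genb.
Proof.
move=> x y; apply: near_decided_iff (near_decided_genb xi m_neq0 (repr (x^-1 * y))).
apply: near_xiS (@near_xi_neq0 m xi) => z z0.
rewrite lcoset_translate; last exact: generated_subgroup.
by rewrite lcoset_genb // normal_form1 // normal_form_proj //; split=> ->.
Qed.

Lemma decided_genbm : decided genbm.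
Proof.
move=> x y; apply: near_decided_iff (near_decided_genbm xi m_neq0 (repr (x^-1 * y))).
apply: near_xiS (@near_xi_neq0 m xi) => z z0.
rewrite lcoset_translate; last exact: generated_subgroup.
rewrite lcoset_genbm // normal_form1 // normal_form_proj //= subr0.
by split=> -[E dv]; split.
Qed.

(** * Change of approximating sequence *)

Section Transfer.
Variable K : forall z, set (BS m z).
Arguments K : clear implicits.
Hypothesis decK : decided K.

Local Notation seqK u := (fun n : nat => K (u n)).

Lemma eq_cls_transfer (u v : nat -> int) x y :
  approximates xi u -> approximates xi v ->
  cls (seqK u) x = cls (seqK u) y -> cls (seqK v) x = cls (seqK v) y.
Proof.
move=> hu hv /eq_cls E; apply/eq_cls.
have [nE|nE] := decK x y; first exact: nE.
(* Otherwise the cosets along [u] would eventually be both equal and distinct. *)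
exfalso; apply: (@filter_not_empty _ (\oo : set_system nat)).
by apply: filterS2 E (nE u hu) => n /= ? [].
Qed.

(** The same word read along the other sequence; the choice of word is harmless by
    [eq_cls_transfer]. *)
Definition transfer (u v : nat -> int) (C : cclass (seqK u)) : cclass (seqK v) :=
  cls (seqK v) (cls_rep C).

Variables u v : nat -> int.
Hypotheses (hu : approximates xi u) (hv : approximates xi v).

Lemma transfer_cls x : transfer v (cls (seqK u) x) = cls (seqK v) x.
Proof. by apply: eq_cls_transfer hu hv _; rewrite cls_repK. Qed.

Lemma transfer_act g C : transfer v (@cls_act m u (seqK u) g C) =
  cls_act g (transfer v C).
Proof.
by rewrite -(cls_repK C) cls_act_cls !transfer_cls cls_act_cls.
Qed.

End Transfer.

Lemma transferK K (decK : decided K) u v : approximates xi u ->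
  approximates xi v ->
  cancel (@transfer K u v) (@transfer K v u).
Proof. by move=> hu hv C; rewrite -(cls_repK C) !(transfer_cls decK). Qed.

Lemma limit_graph_iso u v : approximates xi u -> approximates xi v ->
  equivariant_iso (left_mul_action m u) (left_mul_action m v).
Proof.
move=> hu hv; exists (@transfer genb u v), (@transfer genbm u v); split.
- by exists (@transfer genb v u); apply: (transferK decided_genb).
- by exists (@transfer genbm v u); apply: (transferK decided_genbm).
- move=> e; rewrite -(cls_repK e) (transfer_cls decided_genbm hu hv).
  rewrite /ends image_setU !image_set1 /=.
  by rewrite !XoriginE !XterminusE !(transfer_cls decided_genb hu hv).
- by move=> g C; exact: (transfer_act decided_genb hu hv).
- by move=> g C; exact: (transfer_act decided_genbm hu hv).
Qed.

Lemma limit_graph_factors (R : realType) u (L : marked_group 2) :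
  approximates xi u -> is_limit_BS R xi L ->
  factors_through (left_mul_action m u) (mg_proj L).
Proof.
move=> hu [v hv vL]; apply: factors_through_ker => [x y|g|x Lx].
- exact: mg_projM.
- exact: mg_proj_surj.
have triv (K : forall z, set (BS m z)) : decided K ->
    forall C, @cls_act m u (fun n => K (u n)) x C = C.
  move=> decK C; rewrite -(cls_repK C) cls_act_cls.
  (* The group [L] is a limit along [v] whereas the graph is built from [u]: triviality is shown
     along [v] and transferred. *)
  apply: (eq_cls_transfer decK hv hu); apply/eq_cls.
  apply: filterS (mg_cvg_trivial vL Lx) => n xn.
  by rewrite mg_projM xn mul1g.
by split; [exact: (triv genb decided_genb)|exact: (triv genbm decided_genbm)].
Qed.

(** * The limit graph is a tree *)

Section Tree.
Variable u : nat -> int.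
Hypothesis hu : approximates xi u.
Local Notation X := (limit_graph m u).
Local Notation a := (pgen _ ga : F2).
Local Notation vcls := (@cls m u (@Hb m u)).
Local Notation ecls := (@cls m u (@Hbm m u)).

(** The prefixes of a word for [v^-1 * w] trace a path: a letter [b] fixes the vertex, while [a] or
    its inverse crosses one edge. *)
Lemma limit_graph_connected : is_connected X.
Proof.
move=> x y; rewrite -(cls_repK x) -(cls_repK y).
move: (cls_rep x) (cls_rep y) => {x y} v w.
rewrite -[w](mulVKg v); have [t ->] := wclass_surj (v^-1 * w).
elim/last_ind: t => [|t [i e] IH].
  by rewrite mulg1; exact: reachable_refl.
rewrite -cats1 wclassM mulgA; move: (v * wclass _ t) IH => {t}w IH.
have [->|i_b] := eqVneq i ga.
  rewrite wclass_letter; case: e.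
    apply: (@reachable_step _ _ _ _ (ecls (w * a) : edge X)) IH.
    by rewrite /ends /= XoriginE XterminusE mulgK setUC.
  apply: (@reachable_step _ _ _ _ (ecls w : edge X)) IH.
  by rewrite /ends /= XoriginE XterminusE.
suff -> : vcls (w * wclass _ [:: (i, e)]) = vcls w by [].
apply/esym/eq_cls; apply: nearW => n.
apply/eq_lcoset; first exact: Hb_subgroup.
rewrite mg_projM mulKg wclass_letter.
have -> : i = gb by apply/val_inj; case: i i_b => -[|[|i]].
have Hbb : Hb (mg_gen (BS m (u n)) gb) by exact: sub_generated.
case: e; rewrite ?mg_projV mg_proj_gen //.
exact: subgroupV (@Hb_subgroup m u n) Hbb.
Qed.

Definition vdepth (C : vertex X) : nat :=
  xget 0%N [set r | \forall n \near \oo, depth (pr (u n) (cls_rep C)) = r].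

Lemma approx_neq0 n : u n <> 0%R.
Proof. by case: hu => u0 _ _; apply: u0. Qed.

Lemma vdepthP (w : F2) :
  \forall n \near \oo, depth (pr (u n) w) = vdepth (vcls w).
Proof.
have /xgetPex : [set r | \forall n \near \oo,
    depth (pr (u n) (cls_rep (vcls w))) = r] !=set0.
  have [r nr] := near_size_act_word xi m_neq0 (repr (cls_rep (vcls w))).
  exists r; apply: filterS (nr u hu) => n.
  by rewrite /depth normal_form_proj //; exact: approx_neq0.
move=> /(_ 0%N); rewrite -/(vdepth _) /= => D.
(* The chosen representative eventually lies in the same coset of [b] as [w], hence has the same
   stack. *)
have /eq_cls E := cls_repK (vcls w).
apply: filterS2 D E => n <- /lcoset_genb; rewrite /depth => -> //.
exact: approx_neq0.
Qed.

Lemma near_ends_depth (w : F2) : \forall n \near \oo,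
  depth (pr (u n) w) = vdepth (vcls w) /\
  depth (pr (u n) w * pow_a m (u n) false) = vdepth (vcls (w * a^-1)).
Proof.
apply: filterS2 (vdepthP w) (vdepthP (w * a^-1)) => n -> <-.
by rewrite mg_projM mg_projV mg_proj_gen pow_aE.
Qed.

Lemma vdepth_neq (e : edge X) : vdepth (origin e) <> vdepth (terminus e).
Proof.
rewrite -(cls_repK e) /= XoriginE XterminusE => E.
(* A single index at which both eventual depths are attained suffices. *)
have [n [E1 E2]] := filter_ex (near_ends_depth (cls_rep e)).
have := depth_mula m_neq0 (@approx_neq0 n) (pr (u n) (cls_rep e)) false.
by rewrite E1 E2 -E => -[] /eqP; [rewrite ltn_eqF|rewrite ltn_eqF].
Qed.

Lemma descends_unique (e e' : edge X) v :
  descends vdepth e v -> descends vdepth e' v -> e = e'.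
Proof.
rewrite -(cls_repK e) -(cls_repK e').
move: (cls_rep e) (cls_rep e') => {e e'} w w'.
rewrite /descends /= !XoriginE !XterminusE.
have D := near_ends_depth w; have D' := near_ends_depth w'.
have aE n x : pr (u n) (x * a^-1) = pr (u n) x * pow_a m (u n) false.
  by rewrite mg_projM mg_projV mg_proj_gen pow_aE.
have nz n : u n <> 0%R by exact: approx_neq0.
(* Four cases, as [v] is the origin or the terminus of each edge; the two mixed ones are
   contradictory at a single large index. *)
move=> [] [<- lt] [] [E lt']; rewrite -?E in lt'; move/eq_cls: E => E.
- apply/eq_cls; apply: filterS3 D D' E => n [E1 E2] [E1' E2'] E.
  by apply: (descending_origin_unique m_neq0 (nz n) (esym E));
    rewrite ?E1 ?E2 ?E1' ?E2'.
- have [n [[[E1 E2] [E1' E2']]]] := filter_ex (filterI (filterI D D') E).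
  rewrite aE => /esym En.
  by case: (descending_origin_terminus m_neq0 (nz n) En);
    rewrite ?E1 ?E2 ?E1' ?E2'.
- have [n [[[E1 E2] [E1' E2']]]] := filter_ex (filterI (filterI D D') E).
  rewrite aE => En.
  by case: (descending_origin_terminus m_neq0 (nz n) En);
    rewrite ?E1 ?E2 ?E1' ?E2'.
- apply/eq_cls; apply: filterS3 D D' E => n [E1 E2] [E1' E2'].
  rewrite !aE => /esym En.
  by apply: (descending_terminus_unique m_neq0 (nz n) En);
    rewrite ?E1 ?E2 ?E1' ?E2'.
Qed.

Lemma limit_graph_tree : is_tree X.
Proof.
split; first exact: (inhabits (vcls 1)).
- exact: (limit_graph_connected).
- exact: acyclic_of_height vdepth_neq descends_unique.
Qed.

End Tree.
End LimitGraph.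

Theorem theorem3p5 (R : realType) (m : int) (xi : madic m) (u : nat -> int)
    (hm : m <> 0%R) (hu : approximates xi u) :
  [/\ is_tree (limit_graph m u),
      forall v : nat -> int, approximates xi v ->
        equivariant_iso (left_mul_action m u) (left_mul_action m v)
    & forall L : marked_group 2, is_limit_BS R xi L ->
        factors_through (left_mul_action m u) (mg_proj L)].
Proof.
split; first exact: (limit_graph_tree hm hu).
- by move=> v hv; exact: (limit_graph_iso hm hu hv).
- by move=> L hL; exact: (limit_graph_factors hm hu hL).
Qed.
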